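(* Let $X$ be a set, $I$ a nonempty finite set, and let $\mathcal{F}=(f_i)_{i\in I}$, $f_i:X\to X$, be a family of functions having attractor $A$. Then there exist a metric $d$ on $A$ and a comparison function $\varphi$ such that $d(f_i(x),f_i(y))\le\varphi(d(x,y))$ for every $i\in I$ and every $x,y\in A$.
   Context: $\mathbb{N}=\{0,1,2,\dots\}$ and $\mathbb{N}^*=\{1,2,\dots\}$. $\Lambda(I)=I^{\mathbb{N}^*}$ is the set of infinite words $\alpha=\alpha_1\alpha_2\dots$ with letters in $I$. For $\alpha\in\Lambda(I)$ and $n\in\mathbb{N}$, $[\alpha]_n=\alpha_1\dots\alpha_n$ if $n\ge 1$, and $[\alpha]_0=\lambda$ (the empty word). Put $f_\lambda=\mathrm{Id}_X$, $f_{\alpha_1\dots\alpha_m}=f_{\alpha_1}\circ\dots\circ f_{\alpha_m}$, and $X_\alpha=f_\alpha(X)$ for every finite word $\alpha$. Family having attractor: a family $(f_i)_{i\in I}$ of functions $f_i:X\to X$ with $I$ finite has attractor if: (a) for every $\alpha\in\Lambda(I)$ the set $\bigcap_{n\in\mathbb{N}}X_{[\alpha]_n}$ has a unique element, denoted $a_\alpha$; (b) if $\alpha,\beta\in\Lambda(I)$ and $a_\alpha\ne a_\beta$, then there exists $n_0\in\mathbb{N}$ such that $X_{[\alpha]_{n_0}}\cap X_{[\beta]_{n_0}}=\emptyset$. The attractor is $A=\{a_\alpha\mid\alpha\in\Lambda(I)\}\subseteq X$. (Each $f_i$ maps $A$ into $A$, so the inequality makes sense.) Comparison function: a function $\varphi:[0,\infty)\to[0,\infty)$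 that is increasing (in the weak sense: $s\le t$ implies $\varphi(s)\le\varphi(t)$), satisfies $\varphi(t)<t$ for every $t>0$, and is right-continuous. *)

(* Defs.v *)
From HB Require Import structures.
From mathcomp Require Import all_boot all_order all_algebra.
From mathcomp Require Import all_classical all_reals all_analysis.

Set Implicit Arguments.
Unset Strict Implicit.
Unset Printing Implicit Defensive.

Import Order.TTheory GRing.Theory Num.Theory.
Import numFieldNormedType.Exports.

Local Open Scope classical_set_scope.
Local Open Scope ring_scope.

Section Attractor.
Context {X : Type} {I : finType} (f : I -> X -> X).

(* The empty word gives the identity, a word [:: i1; ...; im] gives
   f i1 \o ... \o f im. *)
Definition word_map (w : seq I) : X -> X := foldr (fun i g => f i \o g) id w.

Definition word_set (w : seq I) : set X := range (word_map w).

(* Infinite words are indexed from 0: the letter alpha_(k+1) is [alpha k], so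
   that the prefix of length n is [mkseq alpha n]. *)
Definition prefix_sets_meet (alpha : nat -> I) : set X :=
  \bigcap_(n in [set: nat]) word_set (mkseq alpha n).

(* [is_coded alpha a] says that the intersection along alpha has a as its
   unique element, i.e. that a_alpha exists and is equal to a. *)
Definition is_coded (alpha : nat -> I) (a : X) : Prop :=
  prefix_sets_meet alpha = [set a].

Definition has_attractor : Prop :=
  (forall alpha, exists a, is_coded alpha a) /\
  (forall alpha beta a b, is_coded alpha a -> is_coded beta b -> a <> b ->
     exists n0, word_set (mkseq alpha n0) `&` word_set (mkseq beta n0) = set0).

Definition attractor : set X := [set a | exists alpha, is_coded alpha a].

Lemma attractor_stable : has_attractor ->
  forall i x, attractor x -> attractor (f i x).
Proof.
move=> [fA _] i x [alpha ax].
pose beta n := if n is k.+1 then alpha k else i.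
have [b bb] := fA beta.
suff : prefix_sets_meet beta (f i x).
  by rewrite bb => ->; exists beta.
have : prefix_sets_meet alpha x by rewrite ax.
move=> xa [|n] _; first by exists (f i x).
have [y _ yx] := xa n Logic.I.
exists y => //.
have -> : mkseq beta n.+1 = i :: mkseq alpha n.
  by rewrite /mkseq/= -[1%N]/(1 + 0)%N iotaDl -map_comp.
by rewrite /= yx.
Qed.

Definition attractor_map (fA : has_attractor) (i : I) (x : attractor) :
    attractor :=
  exist _ (f i (val x))
    (mem_set (attractor_stable fA i (set_mem (valP x)))).

End Attractor.

Definition is_metric (R : realType) (T : Type) (d : T -> T -> R) : Prop :=
  [/\ forall x y, 0 <= d x y,
      forall x y, d x y = 0 <-> x = y,
      forall x y, d x y = d y x &
      forall x y z, d x z <= d x y + d y z].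

(* A function from [0, +oo[ to itself is represented by a function on R whose
   values outside [0, +oo[ are irrelevant. *)
Definition comparison_function (R : realType) (phi : R -> R) : Prop :=
  [/\ forall t, 0 <= t -> 0 <= phi t,
      forall s t, 0 <= s -> s <= t -> phi s <= phi t,
      forall t, 0 < t -> phi t < t &
      forall t, 0 <= t -> phi x @[x --> t^'+] --> phi t].

(* Main.v *)
Require Import Defs.
From HB Require Import structures.
From mathcomp Require Import all_boot all_order all_algebra.
From mathcomp Require Import all_classical all_reals all_analysis.
From mathcomp Require Import lra.

Set Implicit Arguments.
Unset Strict Implicit.
Unset Printing Implicit Defensive.

Import Order.TTheory GRing.Theory Num.Theory.
Import numFieldNormedType.Exports.

Local Open Scope classical_set_scope.
Local Open Scope ring_scope.

(** Call two infinite words n-touching when the sets X_u and X_v of their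
    prefixes u, v of length n meet, and two points of the attractor n-close
    when they have n-touching codes.  By the second clause of [has_attractor],
    words that touch at every level code the same point, and by a compactness
    argument on the space of words [touch_chain] chains of touching words
    compose, at the cost of lowering the level.  So the relations of n-closeness
    are a countable base of a separated uniformity on the attractor
    ([close_by_split], [close_by_separated]), hence come from a bounded metric
    d0.  The maps interact with this base in the best possible way: f_i sends
    n-close points to (n+1)-close ones, and any two points are 0-close.
    Therefore the d0-diameter of f_w(A) tends to 0 uniformly as the length of
    the word w grows.

    The metric d0 need not be contracted by the maps.  It is replaced by
      d(x, y) = sup_w c_|w| d0(f_w x, f_w y)
    over all finite words w, for weights 1 = c_0 < c_1 < c_2 < ... < 2.  In
    d(f_i x, f_i y) the term of w is, up to its weight, the term of the longer
    word wi in d(x, y), whose weight is larger.  For the finitely many lengths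
    |w| < n this gains a factor q_n < 1, while the longer words contribute at
    most a small e_n.  Thus d(f_i x, f_i y) <= max(q_n d(x, y), e_n) for every
    n, with e_n tending to 0 ([almost_contractive_remetrization]).

    Finally phi(t) is the infimum of max(q t, e) over all pairs (q, e) for which
    this inequality holds for all points and all maps.  It dominates the maps by
    construction, taking e = t / 2 gives phi(t) < t, and an infimum of
    continuous nondecreasing functions is nondecreasing and right-continuous
    ([comparison_of_almost_contraction]).  *)

(** * Metrization of a countable base of closeness relations *)

(** The relations [V n] generate a uniformity with a countable base, which is
    pseudometrizable; the bound 2 is the one given by
    [countable_uniform_bounded].  The last two clauses are what remains of the
    equality of the two uniformities: [d] is uniformly small on [V n] for large
    [n], and it separates the points that the [V n] separate.  *)
Lemma pseudometric_of_base (R : realType) (T : Type) (V : nat -> T -> T -> Prop)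
    (V_refl : forall n x, V n x x)
    (V_sym : forall n x y, V n x y -> V n y x)
    (V_le : forall m n x y, (m <= n)%N -> V n x y -> V m x y)
    (V_split : forall n, exists m, forall x y z,
       V m x y -> V m y z -> V n x z) :
  exists d : T -> T -> R,
    [/\ forall x y, 0 <= d x y <= 2,
        forall x y, d x y = d y x,
        forall x y z, d x z <= d x y + d y z,
        forall e, 0 < e -> exists n, forall x y, V n x y -> d x y <= e &
        forall x y, d x y = 0 -> forall n, V n x y].
Proof.
pose ent : set_system (T * T) :=
  [set A | exists n, forall x y, V n x y -> A (x, y)].
have ent_filter : Filter ent.
  split; first by exists 0%N.
    move=> A B [m mA] [n nB]; exists (maxn m n) => x y Vxy; split.
      by apply: mA; apply: V_le Vxy; exact: leq_maxl.
    by apply: nB; apply: V_le Vxy; exact: leq_maxr.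
  by move=> A B AB [n nA]; exists n => x y /nA /AB.
have ent_refl A : ent A -> diagonal `<=` A.
  by move=> [n nA] [x y] /diagonalP -> /=; exact: nA.
have ent_inv A : ent A -> ent (A^-1)%relation.
  by move=> [n nA]; exists n => x y /V_sym /nA.
have ent_split A : ent A -> exists2 B, ent B & (B \; B `<=` A)%relation.
  move=> [n nA]; have [m Vm] := V_split n.
  exists [set xy | V m xy.1 xy.2]; first by exists m.
  by move=> [x z] [y /= Vxy Vyz]; apply: nA; exact: Vm Vxy Vyz.
pose C : choiceType := HB.pack T (gen_eqMixin T) (gen_choiceMixin T).
pose U : uniformType := HB.pack T (Choice.class C)
  (isUniform.Build C ent_filter ent_refl ent_inv ent_split).
have U_countable : countable_uniformity U.
  apply/countable_uniformityP; exists (fun n => [set xy | V n xy.1 xy.2]).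
    by move=> A [n nA]; exists n => -[x y] /nA.
  by move=> n; exists n.
pose M : pseudoMetricType R := countable_uniform U_countable.
pose b (x : T) (e : R) (y : T) := @ball R M x e y.
have entM : ent = entourage_ b by exact: (@entourageE_subproof R M).
pose D (x y : T) := @edist R M (x, y).
have D_le2 x y : (D x y <= 2%:E)%E.
  by apply: edist_fin => //; exact: countable_uniform.countable_uniform_bounded.
have D_fin x y : D x y \is a fin_num.
  rewrite ge0_fin_numE ?edist_ge0//; apply: le_lt_trans (D_le2 x y) _.
  by rewrite ltry.
exists (fun x y => fine (D x y)); split.
- by move=> x y; rewrite fine_ge0 ?edist_ge0//= -lee_fin fineK.
- by move=> x y; rewrite /D edist_sym.
- move=> x y z; rewrite -lee_fin EFinD !fineK//; exact: edist_triangle.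
- move=> e e0.
  have : ent [set xy | b xy.1 e xy.2] by rewrite entM; exists e.
  move=> [n Vb]; exists n => x y /Vb bxy.
  by rewrite -lee_fin fineK//; exact: edist_fin.
- move=> x y Dxy n.
  have : ent [set xy | V n xy.1 xy.2] by exists n.
  rewrite entM => -[e /= e0 /(_ (x, y))]; apply => /=.
  apply: (@edist_lt_ball R M e (x, y)).
  by rewrite -[edist _]fineK ?Dxy ?lte_fin//; exact: D_fin.
Qed.

(** * Comparison functions from almost contractions *)

(** Each valid inequality [d (g j x) (g j y) <= max (q * d x y) e] bounds the
    maps by a continuous nondecreasing function of [d x y], and [phi] is the
    infimum of all of them.  For a given [t > 0] the hypothesis at [e = t / 2]
    provides one that is below [t] at [t].  *)
Lemma comparison_of_almost_contraction (R : realType) (T J : Type)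
    (d : T -> T -> R) (g : J -> T -> T) (d_ge0 : forall x y, 0 <= d x y)
    (d_contr : forall e, 0 < e -> exists q, [/\ 0 <= q, q < 1 &
       forall j x y, d (g j x) (g j y) <= Num.max (q * d x y) e]) :
  exists phi : R -> R, comparison_function phi /\
    forall j x y, d (g j x) (g j y) <= phi (d x y).
Proof.
pose adm : set (R * R) := [set p | [/\ 0 <= p.1, 0 <= p.2 &
  forall j x y, d (g j x) (g j y) <= Num.max (p.1 * d x y) p.2]].
pose S t := [set Num.max (p.1 * t) p.2 | p in adm].
have S_neq0 t : S t !=set0.
  have [q [q0 _ qd]] := d_contr _ ltr01.
  by exists (Num.max (q * t) 1); exists (q, 1).
have S_ge0 t : lbound (S t) 0.
  by move=> _ [p [p1 p2 _] <-]; rewrite le_max p2 orbT.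
have S_inf t p : adm p -> inf (S t) <= Num.max (p.1 * t) p.2.
  by move=> ap; apply: ge_inf; [exists 0; exact: S_ge0 | exists p].
have S_mono s t : s <= t -> inf (S s) <= inf (S t).
  move=> st; apply: lb_le_inf => // _ [p ap <-].
  apply: le_trans (S_inf s p ap) _; have [p1 _ _] := ap.
  by rewrite ge_max !le_max lexx orbT andbT ler_wpM2l.
exists (fun t => inf (S t)); split; last first.
  by move=> j x y; apply: lb_le_inf => // _ [p [_ _ pd] <-].
split.
- by move=> t t0; exact: lb_le_inf.
- by move=> s t _; exact: S_mono.
- move=> t t0; have t2 : 0 < t / 2 by rewrite divr_gt0.
  have [q [q0 q1 qd]] := d_contr _ t2.
  apply: (@le_lt_trans _ _ (Num.max (q * t) (t / 2))).
    by apply: (S_inf t (q, t / 2)); split => //=; exact: ltW.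
  by rewrite gt_max gtr_pMl// q1/=; lra.
- move=> t t0; apply/cvgrPdist_le => e e0.
  have [|_ [p ap <-] pe] := @inf_adherent _ (S t) e e0.
    by split => //; exists 0; exact: S_ge0.
  have [p1 p2 _] := ap.
  move: pe; rewrite gt_max => /andP[p1t p2e].
  (* The slope [p.1] of the almost optimal pair bounds how far to the right of
     [t] its value stays below [inf (S t) + e]; [+ 1] avoids dividing by 0.  *)
  have p1_gt0 : 0 < p.1 + 1 by lra.
  have Dpos : 0 < (inf (S t) + e - p.1 * t) / (p.1 + 1).
    by apply: divr_gt0; rewrite ?subr_gt0.
  near=> s.
  have ts : t <= s by apply: ltW; near: s; exact: nbhs_right_gt.
  rewrite ler0_norm ?subr_le0 ?S_mono// opprB lerBlDl.
  apply: le_trans (S_inf s p ap) _; rewrite ge_max (ltW p2e) andbT.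
  have : (s - t) * (p.1 + 1) <= inf (S t) + e - p.1 * t.
    by rewrite -ler_pdivlMr// ltW//; near: s; exact: nbhs_right_ltDr.
  nra.
Unshelve. all: by end_near. Qed.

(** * Remetrization by weighted suprema over words *)

Lemma word_map_rcons (T : Type) (J : finType) (g : J -> T -> T) w i x :
  word_map g (rcons w i) x = word_map g w (g i x).
Proof. by elim: w => //= j w ->. Qed.

Lemma strictly_increasing_ratio (R : realType) (c : nat -> R)
    (c_gt0 : forall k, 0 < c k) (c_lt : forall k, c k < c k.+1) n :
  exists q, [/\ 0 <= q, q < 1 & forall k, (k < n)%N -> c k <= q * c k.+1].
Proof.
elim: n => [|n [q [q0 q1 qc]]]; first by exists 0.
exists (Num.max q (c n / c n.+1)); split.
- by rewrite le_max q0.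
- by rewrite gt_max q1 ltr_pdivrMr ?mul1r ?c_lt ?c_gt0.
- move=> k; rewrite ltnS leq_eqVlt => /orP[/eqP ->|/qc qk].
    by rewrite -ler_pdivrMr ?c_gt0// le_max lexx orbT.
  by apply: le_trans qk _; rewrite ler_wpM2r ?le_max ?lexx// ltW ?c_gt0.
Qed.

(** The metric is the supremum over words [w] of [d0] between the images under
    [word_map g w], with a weight that increases strictly with the length of
    [w].  Without the weights the maps would only be nonexpansive; with them,
    replacing [w] by [rcons w j] gains a factor that is bounded away from 1 as
    long as the length of [w] is bounded, and [d0_shrink] takes care of the
    long words.  *)
Lemma almost_contractive_remetrization (R : realType) (T : Type) (J : finType)
    (g : J -> T -> T) (d0 : T -> T -> R)
    (d0_bnd : forall x y, 0 <= d0 x y <= 2)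
    (d0_sym : forall x y, d0 x y = d0 y x)
    (d0_tri : forall x y z, d0 x z <= d0 x y + d0 y z)
    (d0_eq0 : forall x y, d0 x y = 0 <-> x = y)
    (d0_shrink : forall e, 0 < e -> exists n, forall w x y, (n <= size w)%N ->
       d0 (word_map g w x) (word_map g w y) <= e) :
  exists d : T -> T -> R, is_metric d /\
    forall e, 0 < e -> exists q, [/\ 0 <= q, q < 1 &
       forall j x y, d (g j x) (g j y) <= Num.max (q * d x y) e].
Proof.
pose c n : R := 2 - n.+1%:R^-1.
have c_lt k : c k < c k.+1.
  by rewrite /c ltrD2l ltrN2 ltf_pV2 ?posrE// ltr_nat.
have c_bnd k : 1 <= c k <= 2.
  have : k.+1%:R^-1 <= 1 :> R by rewrite invf_le1 ?ler1n ?ltr0n.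
  by rewrite /c gerBl invr_ge0 ler0n andbT; move: (_^-1) => u u_le1; lra.
have c_gt0 k : 0 < c k.
  by have /andP[? _] := c_bnd k; exact: lt_le_trans ltr01 _.
have d0_ge0 x y : 0 <= d0 x y by have /andP[] := d0_bnd x y.
pose t x y w := c (size w) * d0 (word_map g w x) (word_map g w y).
have t_le4 x y w : t x y w <= 4.
  have /andP[_ d02] := d0_bnd (word_map g w x) (word_map g w y).
  have /andP[_ c2] := c_bnd (size w).
  have -> : 4 = 2 * 2 :> R by rewrite -natrM.
  by rewrite ler_pM// ltW.
pose d x y := sup (range (t x y)).
have t_le x y w : t x y w <= d x y.
  by apply: ub_le_sup; [exists 4 => _ [v _ <-] | exists w].
have d_le x y e : (forall w, t x y w <= e) -> d x y <= e.
  move=> te; apply: ge_sup => [|_ [w _ <-] //]; by exists (t x y [::]), [::].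
have t_ge0 x y w : 0 <= t x y w by rewrite mulr_ge0// ltW.
have d_ge0 x y : 0 <= d x y := le_trans (t_ge0 x y [::]) (t_le x y [::]).
exists d; split.
  split => // x y.
  - split=> [dxy|->].
      have := t_le x y [::]; rewrite dxy pmulr_rle0// => d0_le0.
      by apply/d0_eq0/le_anti; rewrite d0_le0 d0_ge0.
    apply/le_anti; rewrite d_ge0 andbT; apply: d_le => w.
    by rewrite /t (d0_eq0 _ _).2 ?mulr0.
  - by rewrite /d (_ : t x y = t y x)//; apply/funext => w; rewrite /t d0_sym.
  - move=> z; apply: d_le => w.
    apply: le_trans (lerD (t_le x y w) (t_le y z w)).
    by rewrite /t -mulrDr ler_pM2l.
move=> e e0.
(* Weights are at most 2, so words whose [d0] term is at most [e / 2]
   contribute at most [e].  *)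
have e2 : 0 < e / 2 by rewrite divr_gt0.
have [n d0n] := d0_shrink _ e2.
have [q [q0 q1 cq]] := strictly_increasing_ratio c_gt0 c_lt n.
exists q; split => // j x y; apply: d_le => w.
rewrite /t -!word_map_rcons le_max.
have [wn|nw] := ltnP (size w) n.
  apply/orP; left; apply: le_trans (_ : q * t x y (rcons w j) <= _).
    by rewrite /t size_rcons mulrA ler_wpM2r// cq.
  by rewrite ler_wpM2l.
apply/orP; right.
have /andP[_ c2] := c_bnd (size w).
have -> : e = 2 * (e / 2) by rewrite mulrC divfK.
rewrite ler_pM ?(ltW (c_gt0 _))// d0n// size_rcons.
exact: leqW.
Qed.

(** * Infinite words whose prefix sets meet *)

(** Sequential compactness of the space of infinite words over a finite
    alphabet: the infinite branch of Konig's lemma through the prefixes that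
    occur in infinitely many words of the sequence.  *)
Lemma konig_limit_word (J : finType) (s : nat -> nat -> J) :
  exists a, forall n N, exists2 k, (N <= k)%N & mkseq (s k) n = mkseq a n.
Proof.
pose P w := forall N, exists2 k, (N <= k)%N & mkseq (s k) (size w) = w.
(* Only the one-letter extensions of a recurrent prefix are considered, so the
   letter chosen for a non-recurrent [w] is arbitrary.  *)
have P_rcons w : exists j, P w -> P (rcons w j).
  apply: contrapT => /forallNP nP.
  have Pw : P w by apply: contrapT => nPw; apply: (nP (s 0%N 0%N)).
  have /choice[N_ N_P] j : exists N, forall k, (N <= k)%N ->
      mkseq (s k) (size w).+1 <> rcons w j.
    apply: contrapT => /forallNP nN; apply: (nP j) => _ N; rewrite size_rcons.
    apply: contrapT => nk; apply: (nN N) => k Nk sk; apply: nk.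
    by exists k.
  have [k Nk skw] := Pw (\max_j N_ j)%N.
  apply: (N_P (s k (size w)) k); first exact: leq_trans (leq_bigmax _) Nk.
  by rewrite mkseqS skw.
have [F FP] := choice P_rcons.
pose u n := iter n (fun w => rcons w (F w)) [::].
have mkseq_u n : mkseq (fun k => F (u k)) n = u n.
  by elim: n => //= n IH; rewrite mkseqS IH.
have P_u n : P (u n).
  by elim: n => [N|n]; [exists N | exact: FP].
exists (fun k => F (u k)) => n N; rewrite mkseq_u.
have [k Nk sk] := P_u n N; exists k => //.
by rewrite -[in RHS]sk -mkseq_u size_mkseq.
Qed.

Section Touch.
Context (X : Type) (I : finType) (f : I -> X -> X).
Implicit Types alpha beta gamma delta : nat -> I.

Definition touch n alpha beta : Prop :=
  word_set f (mkseq alpha n) `&` word_set f (mkseq beta n) !=set0.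

Lemma touch_sym n alpha beta : touch n alpha beta -> touch n beta alpha.
Proof. by rewrite /touch setIC. Qed.

Lemma word_set_prefix alpha m n : (m <= n)%N ->
  word_set f (mkseq alpha n) `<=` word_set f (mkseq alpha m).
Proof.
move=> /subnK <-; elim: (n - m)%N => //= k IH.
rewrite addSn mkseqS => _ [x _ <-]; rewrite word_map_rcons.
by apply: IH; exists (f (alpha (k + m)%N) x).
Qed.

Lemma touch_le alpha beta m n : (m <= n)%N ->
  touch n alpha beta -> touch m alpha beta.
Proof.
by move=> mn [x [xa xb]]; exists x; split; apply: word_set_prefix mn _ _.
Qed.

Lemma touch_same_point alpha beta a n :
  is_coded f alpha a -> is_coded f beta a -> touch n alpha beta.
Proof.
move=> fa fb; exists a; split.
  have : prefix_sets_meet f alpha a by rewrite fa.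
  exact.
have : prefix_sets_meet f beta a by rewrite fb.
exact.
Qed.

Lemma same_point_of_touch (fA : has_attractor f) alpha beta a b :
  is_coded f alpha a -> is_coded f beta b ->
  (forall n, touch n alpha beta) -> a = b.
Proof.
move=> fa fb ab; apply: contrapT => a_neq_b.
have [n] := fA.2 _ _ _ _ fa fb a_neq_b.
by have [x abx] := ab n => E; rewrite E in abx.
Qed.

(** If chains of three touching pairs never forced their ends to touch at level
    [n], a limit of counterexamples at all levels would give four words that
    touch successively at every level.  They would code the same point, so the
    ends would touch after all, and touching at level [n] only depends on the
    prefixes of length [n], which limit and counterexample share.  Chains of
    length three, rather than two, are what is needed to pass from words to
    points, each of which may have several codes.  *)
Lemma touch_chain (fA : has_attractor f) n : exists m,
  forall alpha beta gamma delta, touch m alpha beta ->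
    touch m beta gamma -> touch m gamma delta -> touch n alpha delta.
Proof.
apply: contrapT => /forallNP no_m.
have /choice[s s_chain] m : exists s : nat -> I * I * I * I,
    [/\ touch m (fun i => (s i).1.1.1) (fun i => (s i).1.1.2),
        touch m (fun i => (s i).1.1.2) (fun i => (s i).1.2),
        touch m (fun i => (s i).1.2) (fun i => (s i).2) &
        ~ touch n (fun i => (s i).1.1.1) (fun i => (s i).2)].
  apply: contrapT => /forallNP no_s; apply: (no_m m) => a b c d ab bc cd.
  apply: contrapT => nad.
  by apply: (no_s (fun i => (a i, b i, c i, d i))).
(* A single limit for the quadruples makes the four words converge along the
   same indices.  *)
have [l l_lim] := konig_limit_word s.
have mkseq_lim k j (p : I * I * I * I -> I) : mkseq (s k) j = mkseq l j ->
    mkseq (fun i => p (s k i)) j = mkseq (fun i => p (l i)) j.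
  by rewrite /mkseq (map_comp p (s k)) (map_comp p l) => ->.
have lim_touch (p q : I * I * I * I -> I) :
    (forall m, touch m (fun i => p (s m i)) (fun i => q (s m i))) ->
    forall j, touch j (fun i => p (l i)) (fun i => q (l i)).
  move=> pq j; have [k jk skj] := l_lim j j.
  have := touch_le jk (pq k).
  by rewrite /touch !(mkseq_lim k j).
have [a fa] := fA.1 (fun i => (l i).1.1.1).
have [b fb] := fA.1 (fun i => (l i).1.1.2).
have [c fc] := fA.1 (fun i => (l i).1.2).
have [d fd] := fA.1 (fun i => (l i).2).
have ab : a = b.
  apply: (same_point_of_touch fA fa fb).
  apply: (lim_touch (fun t => t.1.1.1) (fun t => t.1.1.2)) => m.
  by have [] := s_chain m.
have bc : b = c.
  apply: (same_point_of_touch fA fb fc).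
  apply: (lim_touch (fun t => t.1.1.2) (fun t => t.1.2)) => m.
  by have [] := s_chain m.
have cd : c = d.
  apply: (same_point_of_touch fA fc fd).
  apply: (lim_touch (fun t => t.1.2) (fun t => t.2)) => m.
  by have [] := s_chain m.
rewrite -cd -bc -ab in fd.
have [k _ skn] := l_lim n 0%N.
have [_ _ _] := s_chain k; apply.
rewrite /touch (mkseq_lim k n (fun t => t.1.1.1))//.
rewrite (mkseq_lim k n (fun t => t.2))//.
exact: touch_same_point fa fd.
Qed.

Definition cons_code (i : I) alpha : nat -> I :=
  fun n => if n is k.+1 then alpha k else i.

Lemma mkseq_cons_code i alpha n :
  mkseq (cons_code i alpha) n.+1 = i :: mkseq alpha n.
Proof. by rewrite /mkseq/= -[1%N]/(1 + 0)%N iotaDl -map_comp. Qed.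

Lemma cons_code_coded (fA : has_attractor f) i alpha a :
  is_coded f alpha a -> is_coded f (cons_code i alpha) (f i a).
Proof.
move=> fa; have [b fb] := fA.1 (cons_code i alpha).
suff : prefix_sets_meet f (cons_code i alpha) (f i a) by rewrite fb => ->.
have : prefix_sets_meet f alpha a by rewrite fa.
move=> aP [|n] _; first by exists (f i a).
by have [y _ ya] := aP n Logic.I; exists y; rewrite // mkseq_cons_code /= ya.
Qed.

Lemma touch_cons_code i alpha beta n : touch n alpha beta ->
  touch n.+1 (cons_code i alpha) (cons_code i beta).
Proof.
move=> [_ [[x _ <-] [y _ yx]]]; exists (f i (word_map f (mkseq alpha n) x)).
by split; rewrite mkseq_cons_code; [exists x | exists y; rewrite //= yx].
Qed.

End Touch.

(** * The uniform structure of the attractor *)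

Definition close_by (X : Type) (I : finType) (f : I -> X -> X) (n : nat)
    (x y : attractor f) : Prop :=
  exists alpha beta, [/\ is_coded f alpha (val x), is_coded f beta (val y) &
    touch f n alpha beta].

Section CloseBy.
Context (X : Type) (I : finType) (f : I -> X -> X) (fA : has_attractor f).
Implicit Types x y z : attractor f.

Lemma attractor_coded x : exists alpha, is_coded f alpha (val x).
Proof. exact: set_mem (valP x). Qed.

Lemma close_by0 x y : close_by 0 x y.
Proof.
have [alpha fx] := attractor_coded x; have [beta fy] := attractor_coded y.
exists alpha, beta; split => //.
by exists (val x); split; exists (val x).
Qed.

Lemma close_by_refl n x : close_by n x x.
Proof.
have [alpha fx] := attractor_coded x.
by exists alpha, alpha; split => //; exact: (touch_same_point n fx fx).
Qed.

Lemma close_by_sym n x y : close_by n x y -> close_by n y x.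
Proof.
by move=> [a [b [fa fb ab]]]; exists b, a; split => //; exact: touch_sym.
Qed.

Lemma close_by_le m n x y : (m <= n)%N -> close_by n x y -> close_by m x y.
Proof.
by move=> mn [a [b [fa fb ab]]]; exists a, b; split => //; exact: touch_le ab.
Qed.

(** The middle link of the chain joins the two codes of [y], which touch at
    every level.  *)
Lemma close_by_split n : exists m, forall x y z,
  close_by m x y -> close_by m y z -> close_by n x z.
Proof.
have [m chain] := touch_chain fA n; exists m => x y z.
move=> [a [b [fa fb ab]]] [c [d [fc fd cd]]]; exists a, d; split => //.
by apply: chain ab _ cd; exact: touch_same_point fb fc.
Qed.

(** The codes that witness closeness vary with the level; [touch_chain] links
    them to codes of [x] and [y] chosen once and for all.  *)
Lemma close_by_separated x y : (forall n, close_by n x y) -> x = y.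
Proof.
have [alpha fx] := attractor_coded x; have [beta fy] := attractor_coded y.
move=> xy; apply: val_inj; apply: (same_point_of_touch fA fx fy) => n.
have [m chain] := touch_chain fA n; have [a [b [fa fb ab]]] := xy m.
by apply: chain ab _;
  [exact: touch_same_point fx fa | exact: touch_same_point fb fy].
Qed.

Lemma close_by_map i n x y : close_by n x y ->
  close_by n.+1 (attractor_map fA i x) (attractor_map fA i y).
Proof.
move=> [a [b [fa fb ab]]]; exists (cons_code i a), (cons_code i b).
by split;
  [exact: cons_code_coded | exact: cons_code_coded | exact: touch_cons_code].
Qed.

Lemma close_by_word_map w x y : close_by (size w)
  (word_map (attractor_map fA) w x) (word_map (attractor_map fA) w y).
Proof. by elim: w => [|i w IH] /=; [exact: close_by0 | exact: close_by_map]. Qed.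

End CloseBy.

(** * Contraction on the attractor *)

Theorem theorem3p4 (R : realType) (X : Type) (I : finType)
    (I_nonempty : (0 < #|I|)%N) (f : I -> X -> X) (fA : has_attractor f) :
  exists (d : attractor f -> attractor f -> R) (phi : R -> R),
    [/\ is_metric d,
        comparison_function phi &
        forall (i : I) (x y : attractor f),
          d (attractor_map fA i x) (attractor_map fA i y) <= phi (d x y)].
Proof.
have [d0 [d0_bnd d0_sym d0_tri d0_small d0_eq0]] :=
  pseudometric_of_base R (@close_by_refl _ _ f) (@close_by_sym _ _ f)
    (@close_by_le _ _ f) (close_by_split fA).
have d0_metric x y : d0 x y = 0 <-> x = y.
  split=> [/d0_eq0/(close_by_separated fA)//|->].
  apply/le_anti/andP; split; last by have /andP[] := d0_bnd y y.
  apply/ler_addgt0Pr => e /d0_small[n nd0]; rewrite add0r.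
  exact/nd0/close_by_refl.
have d0_shrink e : 0 < e -> exists n, forall w x y, (n <= size w)%N ->
    d0 (word_map (attractor_map fA) w x) (word_map (attractor_map fA) w y) <= e.
  move=> /d0_small[n nd0]; exists n => w x y nw.
  exact/nd0/(close_by_le nw)/close_by_word_map.
have [d [d_metric d_contr]] :=
  almost_contractive_remetrization d0_bnd d0_sym d0_tri d0_metric d0_shrink.
have [d_ge0 _ _ _] := d_metric.
have [phi [phi_cmp phiP]] := comparison_of_almost_contraction d_ge0 d_contr.
by exists d, phi.
Qed.
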